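(* Let $d,n,k\ge1$ be integers and $\eta>0$. There exist $k$ linear-attention transformer layers $\mathsf{TF}_1,\dots,\mathsf{TF}_k$, each with one head and hidden dimension $d_{\mathsf{hid}}=3d$, and a linear readout vector $W_O\in\mathbb{R}^{1\times 3d}$, none depending on the data, such that the following holds for all $\tilde x_1,\dots,\tilde x_{n+1}\in\mathbb{R}^d$ and $y_1,\dots,y_n\in\mathbb{R}$. Let $H^{(0)}\in\mathbb{R}^{3d\times(n+1)}$ be any matrix of the form $$H^{(0)}=\begin{pmatrix}\tilde x_1&\cdots&\tilde x_n&\tilde x_{n+1}\\ y_1&\cdots&y_n&0\\ *&\cdots&*&*\end{pmatrix}$$ (with arbitrary entries in rows $d+2,\dots,3d$), let $H^{(\ell)}=\mathsf{TF}_\ell(H^{(\ell-1)})$ for $\ell=1,\dots,k$, and let $\hat y^{\ell}_{n+1}$ be the last entry of $W_OH^{(\ell)}$. Then for every $\ell=0,1,\dots,k$, $$\hat y^{\ell}_{n+1}=\langle w^{\ell}_{\mathsf{gd}},\tilde x_{n+1}\rangle,$$ where $w^0_{\mathsf{gd}}=0$ and, for $\ell=0,\dots,k-1$, $$w^{\ell+1}_{\mathsf{gd}}=w^{\ell}_{\mathsf{gd}}-\eta\nabla\tilde L(w^{\ell}_{\mathsf{gd}}),\qquad \tilde L(w)=\frac1{2n}\sum_{i=1}^n\big(y_i-\langle w,\tilde x_i\rangle\big)^2 .$$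
   Context: A one-head linear-attention transformer layer with hidden dimension $d_{\mathsf{hid}}$ acting on $H\in\mathbb{R}^{d_{\mathsf{hid}}\times m}$ (here $m=n+1$) is the map $$\mathsf{TF}(H)=W_1\big(H+(W_VH)\,M\,(W_KH)^\top(W_QH)\big),$$ with parameters $W_1,W_V,W_K,W_Q\in\mathbb{R}^{d_{\mathsf{hid}}\times d_{\mathsf{hid}}}$ and mask $M=\begin{pmatrix}I_n&0\\0&0\end{pmatrix}\in\mathbb{R}^{m\times m}$. In the paper the $\tilde x_i$ are preprocessed features $\tilde x_i=\hat R x_i$ produced by an earlier layer. *)

(* Defs.v *)
From HB Require Import structures.
From mathcomp Require Import all_boot all_order all_algebra.
From mathcomp Require Import all_classical all_reals all_analysis.

Set Implicit Arguments.
Unset Strict Implicit.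
Unset Printing Implicit Defensive.

Import Order.TTheory GRing.Theory Num.Theory.
Import numFieldNormedType.Exports.

Local Open Scope ring_scope.

Definition inner (R : realType) (d : nat) (u v : 'cV[R]_d) : R :=
  \sum_(i < d) u i ord0 * v i ord0.

Definition gradient (R : realType) (d : nat) (f : 'cV[R]_d -> R)
    (w : 'cV[R]_d) : 'cV[R]_d :=
  \col_(i < d) 'D_(delta_mx i ord0) (f : 'cV[R]_d -> R^o) w.

(* The n + 1 columns are split as 'I_(n + 1): [lshift 1 i] is the i-th labelled
   example and [rshift n ord0] is the query column. *)
Definition query (n : nat) : 'I_(n + 1) := rshift n ord0.

Record tf_layer (R : realType) (D : nat) := TFLayer {
  W1 : 'M[R]_D;
  WV : 'M[R]_D;
  WK : 'M[R]_D;
  WQ : 'M[R]_D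
}.

Definition mask (R : realType) (n : nat) : 'M[R]_(n + 1) :=
  block_mx 1%:M 0 0 0.

Definition tf_apply (R : realType) (D n : nat) (T : tf_layer R D)
    (H : 'M[R]_(D, n + 1)) : 'M[R]_(D, n + 1) :=
  W1 T *m (H + (WV T *m H) *m mask R n *m (WK T *m H)^T *m (WQ T *m H)).

Definition hidden_state (R : realType) (D n : nat) (layers : seq (tf_layer R D))
    (H0 : 'M[R]_(D, n + 1)) (l : nat) : 'M[R]_(D, n + 1) :=
  foldl (fun H T => tf_apply T H) H0 (take l layers).

Definition readout (R : realType) (D n : nat) (WO : 'rV[R]_D)
    (H : 'M[R]_(D, n + 1)) : R :=
  (WO *m H) ord0 (query n).

(* Rows are numbered from 0: rows 0, ..., d - 1 hold the features, row d holds
   the labels, and the remaining rows d + 1, ..., 3d - 1 are unconstrained. *)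
Definition is_prompt (R : realType) (d n : nat) (x : 'I_(n + 1) -> 'cV[R]_d)
    (y : 'I_n -> R) (H : 'M[R]_(3 * d, n + 1)) : Prop :=
  [/\ forall (r : 'I_(3 * d)) (i : 'I_d) (j : 'I_(n + 1)),
        r = i :> nat -> H r j = x j i ord0,
      forall (r : 'I_(3 * d)) (j : 'I_n),
        r = d :> nat -> H r (lshift 1 j) = y j
    & forall r : 'I_(3 * d), r = d :> nat -> H r (query n) = 0].

Definition loss (R : realType) (d n : nat) (x : 'I_(n + 1) -> 'cV[R]_d)
    (y : 'I_n -> R) (w : 'cV[R]_d) : R :=
  (2 * n%:R)^-1 * \sum_(i < n) (y i - inner w (x (lshift 1 i))) ^+ 2.

Fixpoint w_gd (R : realType) (d n : nat) (eta : R)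
    (x : 'I_(n + 1) -> 'cV[R]_d) (y : 'I_n -> R) (l : nat) : 'cV[R]_d :=
  if l is l'.+1 then
    w_gd eta x y l' - eta *: gradient (loss x y) (w_gd eta x y l')
  else 0.

(* Main.v *)
(** Each layer leaves the feature rows untouched and uses row [d] to store the
    residuals: after [l] layers its [j]-th entry is [y_j - <w_l, x_j>] (with the
    convention [y_j = 0] on the query).  A gradient step adds
    [(eta / n) \sum_i r_i x_i] to [w], where [r_i] are the residuals, hence
    subtracts [(eta / n) \sum_i r_i <x_i, x_j>] from the [j]-th residual.  This
    is what linear attention with features as keys and queries and residuals as
    values computes.  The prediction is minus the residual of the query. *)
Require Import Defs.
From HB Require Import structures.
From mathcomp Require Import all_boot all_order all_algebra.
From mathcomp Require Import all_classical all_reals all_analysis.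
From mathcomp Require Import ring.

Set Implicit Arguments.
Unset Strict Implicit.
Unset Printing Implicit Defensive.

Import Order.TTheory GRing.Theory Num.Theory.
Import numFieldNormedType.Exports.

Local Open Scope ring_scope.

(** Along the line through [w] the difference quotient is exactly [a + h * b] for [h != 0], so its
    limit at 0 can be read off. *)
Lemma derive_quadratic (R : realType) (V : normedModType R) (f : V -> R^o)
    (w v : V) (a b : R) :
  (forall h : R, f (h *: v + w) = f w + h * a + h ^+ 2 * b) -> 'D_v f w = a.
Proof.
move=> fE; apply: cvg_lim => //.
(* The limit is written as the value of [a + h * b] at [h = 0], the shape that [cvgD] and [cvgMl]
   produce. *)
have -> : a = a + 0 * b by rewrite mul0r addr0.
apply: (@cvg_trans _ ((fun h : R => a + h * b) @ 0^')%classic).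
  apply: near_eq_cvg; near=> h.
  have h0 : h != 0 by near: h; exact: nbhs_dnbhs_neq.
  by rewrite /= fE /GRing.scale /=; field.
apply: cvgD; first exact: cvg_cst.
apply: cvgMl; exact: nbhs_dnbhs.
Unshelve. all: by end_near. Qed.

Lemma innerDl (R : realType) (d : nat) (u v x : 'cV[R]_d) :
  inner (u + v) x = inner u x + inner v x.
Proof.
by rewrite /inner -big_split; apply: eq_bigr => i _; rewrite mxE mulrDl.
Qed.

Lemma innerZl (R : realType) (d : nat) (a : R) (u x : 'cV[R]_d) :
  inner (a *: u) x = a * inner u x.
Proof.
by rewrite /inner mulr_sumr; apply: eq_bigr => i _; rewrite mxE mulrA.
Qed.

Lemma inner0l (R : realType) (d : nat) (x : 'cV[R]_d) : inner 0 x = 0.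
Proof. by rewrite /inner big1 // => i _; rewrite mxE mul0r. Qed.

Lemma inner_suml (R : realType) (d : nat) (I : finType) (u : I -> 'cV[R]_d)
    (x : 'cV[R]_d) :
  inner (\sum_i u i) x = \sum_i inner (u i) x.
Proof.
apply: (big_morph (fun u => inner u x)) => [v w|]; first exact: innerDl.
exact: inner0l.
Qed.

Lemma inner_delta (R : realType) (d : nat) (i : 'I_d) (x : 'cV[R]_d) :
  inner (delta_mx i ord0) x = x i ord0.
Proof.
rewrite /inner (bigD1 i) //= big1 ?mxE ?eqxx ?mul1r ?addr0 // => j ji.
by rewrite mxE (negbTE ji) mul0r.
Qed.

Lemma gradient_loss (R : realType) (d n : nat) (x : 'I_(n + 1) -> 'cV[R]_d)
    (y : 'I_n -> R) (w : 'cV[R]_d) :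
  gradient (loss x y) w =
  - n%:R^-1 *: \sum_(i < n) (y i - inner w (x (lshift 1 i))) *: x (lshift 1 i).
Proof.
apply/colP => i; rewrite !mxE summxE.
under eq_bigr do rewrite mxE.
(* The explicit argument is the coefficient of [h ^+ 2] when [w] moves along the [i]-th basis
   vector. *)
apply: (@derive_quadratic _ _ _ _ _ _
  ((2 * n%:R)^-1 * \sum_(j < n) x (lshift 1 j) i ord0 ^+ 2)) => h.
(* With this common factor both sides can be compared summand by summand; the identity survives
   [n = 0], where both inverses are 0. *)
have -> : n%:R^-1 = 2 * (2 * n%:R)^-1 :> R.
  by rewrite invfM mulrA divff ?mul1r ?pnatr_eq0.
rewrite /loss; set c := (2 * n%:R)^-1.
rewrite !mulr_sumr -!big_split /=; apply: eq_bigr => j _.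
by rewrite innerDl innerZl inner_delta; ring.
Qed.

(** Keys and queries are projected onto the first [d] rows; the value matrix has one nonzero
    position, so attention reads and writes row [e] alone. *)
Definition gd_layer (R : realType) (D d : nat) (e : 'I_D) (c : R) :
    tf_layer R D :=
  TFLayer 1%:M (- c *: delta_mx e e) (pid_mx d) (pid_mx d).

Lemma pid_mx_mulE (R : pzRingType) (D m d : nat) (H : 'M[R]_(D, m)) r j :
  (pid_mx d *m H : 'M[R]_(D, m)) r j = if (r < d)%N then H r j else 0.
Proof.
rewrite mxE (bigD1 r) //= big1 => [|s sr].
  by rewrite mxE eqxx addr0; case: ifP => _; rewrite ?mul1r ?mul0r.
by rewrite mxE eq_sym (inj_eq val_inj) (negbTE sr) mul0r.
Qed.

Lemma mul_mask (R : realType) (m n p : nat) (A : 'M[R]_(m, n + 1))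
    (B : 'M[R]_(n + 1, p)) r j :
  (A *m Defs.mask R n *m B) r j =
  \sum_(i < n) A r (lshift 1 i) * B (lshift 1 i) j.
Proof.
rewrite -[A in LHS]hsubmxK -[B in LHS]vsubmxK mul_row_block !mulmx0 !addr0 mulmx1.
rewrite mul_row_col mul0mx addr0 mxE.
by apply: eq_bigr => i _; rewrite !mxE.
Qed.

Lemma tf_apply_gd_layer (R : realType) (D d n : nat) (le_dD : (d <= D)%N)
    (e : 'I_D) (c : R) (x : 'I_(n + 1) -> 'cV[R]_d) (H : 'M[R]_(D, n + 1)) :
  (forall i j, H (widen_ord le_dD i) j = x j i ord0) ->
  forall r j, tf_apply (gd_layer d e c) H r j =
    H r j - (r == e)%:R *
      (c * \sum_(i < n) H e (lshift 1 i) * inner (x (lshift 1 i)) (x j)).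
Proof.
move=> Hx r j; rewrite /tf_apply /= mul1mx mxE; congr (_ + _).
(* Grouping the transposed keys with the queries turns attention into a sum, over labelled examples,
   of a value entry times a key-query product. *)
rewrite -mulmxA mul_mask mulr_sumr mulr_sumr -sumrN.
apply: eq_bigr => i _.
have -> : ((- c *: delta_mx e e) *m H) r (lshift 1 i) =
    - c * (r == e)%:R * H e (lshift 1 i).
  rewrite mxE (bigD1 e) //= big1 => [|s se]; last first.
    by rewrite !mxE (negbTE se) andbF mulr0 mul0r.
  by rewrite !mxE eqxx andbT addr0.
have -> : ((pid_mx d *m H)^T *m (pid_mx d *m H : 'M[R]_(D, _))) (lshift 1 i) j =
    inner (x (lshift 1 i)) (x j).
  rewrite mxE /inner.
  transitivity (\sum_(s < D | (s < d)%N) H s (lshift 1 i) * H s j).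
    rewrite [RHS]big_mkcond; apply: eq_bigr => s _.
    by rewrite mxE !pid_mx_mulE; case: ifP => _; rewrite ?mul0r.
  by rewrite (big_ord_narrow le_dD); apply: eq_bigr => s _; rewrite !Hx.
ring.
Qed.

Lemma hidden_stateS (R : realType) (D n k : nat) (T : tf_layer R D)
    (H : 'M[R]_(D, n + 1)) (l : nat) :
  (l < k)%N ->
  hidden_state (nseq k T) H l.+1 = tf_apply T (hidden_state (nseq k T) H l).
Proof.
move=> lk; rewrite /hidden_state (take_nth T) ?size_nseq // nth_nseq lk.
by rewrite foldl_rcons.
Qed.

(** Both invariants go through the induction together, since the next residual update needs intact
    features. Using [H0 e j] instead of a label covers the query column too. *)
Lemma hidden_state_gd (R : realType) (D d n k : nat) (le_dD : (d <= D)%N)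
    (e : 'I_D) (eta : R) (x : 'I_(n + 1) -> 'cV[R]_d) (y : 'I_n -> R)
    (H0 : 'M[R]_(D, n + 1)) :
  (d <= e)%N ->
  (forall i j, H0 (widen_ord le_dD i) j = x j i ord0) ->
  (forall j, H0 e (lshift 1 j) = y j) ->
  forall l, (l <= k)%N ->
    let H := hidden_state (nseq k (gd_layer d e (eta / n%:R))) H0 l in
    (forall i j, H (widen_ord le_dD i) j = x j i ord0) /\
    (forall j, H e j = H0 e j - inner (w_gd eta x y l) (x j)).
Proof.
move=> de H0x H0y; elim=> [_|l IHl lk] /=.
  rewrite /hidden_state take0 /=; split=> // j.
  by rewrite inner0l subr0.
have [Hx He] := IHl (ltnW lk); rewrite hidden_stateS //; split=> [i j|j].
  rewrite (tf_apply_gd_layer _ _ Hx) Hx.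
  suff /negbTE -> : widen_ord le_dD i != e by rewrite mul0r subr0.
  by apply: contraTneq de => <-; rewrite -ltnNge /=.
rewrite (tf_apply_gd_layer _ _ Hx) He eqxx mul1r gradient_loss.
rewrite -[- (eta *: _)]scaleNr innerDl !innerZl inner_suml.
(* Absorbing each residual into the inner product makes the attention sum and the gradient sum
   identical, hence one atom for [ring]. *)
under eq_bigr do rewrite He H0y -innerZl.
ring.
Qed.

Theorem proposition5p2 (R : realType) (d n k : nat) (eta : R)
    (hd : (1 <= d)%N) (hn : (1 <= n)%N) (hk : (1 <= k)%N) (heta : 0 < eta) :
  exists (layers : k.-tuple (tf_layer R (3 * d))) (WO : 'rV[R]_(3 * d)),
    forall (x : 'I_(n + 1) -> 'cV[R]_d) (y : 'I_n -> R)
           (H0 : 'M[R]_(3 * d, n + 1)),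
      is_prompt x y H0 ->
      forall l : nat, (l <= k)%N ->
        readout WO (hidden_state layers H0 l)
        = inner (w_gd eta x y l) (x (query n)).
Proof.
have le_d3 : (d <= 3 * d)%N by rewrite leq_pmull.
have lt_d3 : (d < 3 * d)%N by rewrite ltn_Pmull.
pose e := Ordinal lt_d3.
(* One layer is repeated [k] times; [eta / n%:R] merges the step size with the averaging factor of
   the gradient. *)
exists (nseq_tuple k (gd_layer d e (eta / n%:R))), (- delta_mx ord0 e).
move=> x y H0 [H0x H0y H0q] l lk.
have [||_ He] := @hidden_state_gd _ _ _ _ k le_d3 e eta x y H0 (leqnn d) _ _ l lk.
- by move=> i j; apply: H0x.
- by move=> j; apply: H0y.
rewrite /readout mulNmx -rowE !mxE.
by rewrite [LHS]/= He H0q // sub0r opprK.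
Qed.
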